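(* Let $\mathcal{H}$ and $\mathcal{G}$ be real Hilbert spaces, let $L\in\mathcal{B}(\mathcal{H},\mathcal{G})$ be bounded below with $\|L\|\leq 1$, and let $\gamma\in\,]0,+\infty[$. Then the following hold: (i) $T_\gamma\colon(\mathcal{S}(\mathcal{G}),d_T^{\mathcal{G}})\to(\mathcal{S}(\mathcal{H}),d_T^{\mathcal{H}})\colon B\mapsto L\overset{\gamma}{\bullet}B$ is nonexpansive, i.e., for all $A,B\in\mathcal{S}(\mathcal{G})$, $$d_T^{\mathcal{H}}\bigl(L\overset{\gamma}{\bullet}A,\,L\overset{\gamma}{\bullet}B\bigr)\leq d_T^{\mathcal{G}}(A,B).$$ (ii) $R_\gamma\colon(\mathcal{S}(\mathcal{G}),d_T^{\mathcal{G}})\to(\mathcal{S}(\mathcal{H}),d_T^{\mathcal{H}})\colon B\mapsto L\overset{\gamma}{\diamond}B$ is nonexpansive, i.e., for all $A,B\in\mathcal{S}(\mathcal{G})$, $$d_T^{\mathcal{H}}\bigl(L\overset{\gamma}{\diamond}A,\,L\overset{\gamma}{\diamond}B\bigr)\leq d_T^{\mathcal{G}}(A,B).$$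
   Context: $\mathcal{B}(\mathcal{H},\mathcal{G})$ is the space of bounded linear operators from $\mathcal{H}$ to $\mathcal{G}$, $\mathcal{B}(\mathcal{H})=\mathcal{B}(\mathcal{H},\mathcal{H})$, and $L^*$ is the adjoint of $L$. $\mathcal{P}(\mathcal{H})$ is the set of self-adjoint $A\in\mathcal{B}(\mathcal{H})$ with $\langle Ax,x\rangle\geq 0$ for all $x\in\mathcal{H}$. For self-adjoint $A,B$, $A\preccurlyeq B$ means $B-A\in\mathcal{P}(\mathcal{H})$. $\mathcal{S}(\mathcal{H})$ is the set of $A\in\mathcal{P}(\mathcal{H})$ for which there exists $\alpha>0$ with $\alpha\,\mathrm{Id}_{\mathcal{H}}\preccurlyeq A$. $L$ is bounded below if there exists $\alpha>0$ such that $\alpha\|x\|\leq\|Lx\|$ for all $x\in\mathcal{H}$. For a set-valued operator $M\colon\mathcal{G}\to 2^{\mathcal{G}}$, $M^{-1}$ is the set-valued inverse ($x\in M^{-1}y\Leftrightarrow y\in Mx$); sums and compositions are taken in the set-valued sense, e.g. $(L^*\circ M\circ L)x=\{L^*y : y\in M(Lx)\}$; a set-valued operator all of whose values are singletons is identified with the corresponding single-valued operator. The parallel composition of $M$ by $L^*$ is $L^*\triangleright M=(L^*\circ M^{-1}\circ L)^{-1}$. For $\gamma\in\,]0,+\infty[$, the resolvent composition is $L\overset{\gamma}{\diamond}M=L^*\triangleright(M+\gamma^{-1}\mathrm{Id}_{\mathcal{G}})-\gamma^{-1}\mathrm{Id}_{\mathcal{H}}$, and the resolvent cocomposition is $L\overset{\gamma}{\bullet}M=\bigl(L\overset{1/\gamma}{\diamond}M^{-1}\bigr)^{-1}$.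 The Thompson metric on $\mathcal{S}(\mathcal{H})$ is $d_T^{\mathcal{H}}(A,B)=\ln\bigl(\max\{g(A,B),g(B,A)\}\bigr)$, where $g(A,B)=\inf\{\lambda\in\,]0,+\infty[\; : A\preccurlyeq\lambda B\}$; similarly for $d_T^{\mathcal{G}}$ on $\mathcal{S}(\mathcal{G})$. *)

(* Defs.v *)
From HB Require Import structures.
From mathcomp Require Import all_boot all_order all_algebra.
From mathcomp Require Import all_classical all_reals all_analysis.

Set Implicit Arguments.
Unset Strict Implicit.
Unset Printing Implicit Defensive.

Import Order.TTheory GRing.Theory Num.Theory.
Import numFieldNormedType.Exports.

Local Open Scope classical_set_scope.
Local Open Scope ring_scope.

HB.mixin Record CompleteNormedModule_isHilbert (R : realType) H
    & CompleteNormedModule R H := {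
  inner : {dot H for @idfun R} ;
  sqr_normE : forall x : H, `|x| ^+ 2 = inner x x
}.

#[short(type="hilbertType")]
HB.structure Definition Hilbert (R : realType) :=
  {H of CompleteNormedModule R H & CompleteNormedModule_isHilbert R H}.

Section BoundedOperators.
Context {R : realType}.
Implicit Types H G : hilbertType R.

Definition bounded_op {H G} : set (H -> G) :=
  [set L | linear L /\ exists M : R, forall x, `|L x| <= M * `|x|].

Definition bounded_below {H G} (L : H -> G) : Prop :=
  exists2 alpha : R, 0 < alpha & forall x, alpha * `|x| <= `|L x|.

(* As a supremum in [R], meaningful only for [L] in [bounded_op]. *)
Definition opnorm {H G} (L : H -> G) : R :=
  sup [set `|L x| | x in [set x | `|x| <= 1]].

(* For [L] in [bounded_op] the representing vector exists and is unique (Riesz);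
   the value 0 is only the default of the choice operator. *)
Definition adjoint {H G} (L : H -> G) : G -> H :=
  fun y => xget 0 [set z | forall x, inner (L x) y = inner x z].

Definition positive_op {H} : set (H -> H) :=
  [set A | [/\ bounded_op A, adjoint A = A & forall x, 0 <= inner (A x) x]].

(* Only meant for self-adjoint [A] and [B]. *)
Definition loewner_le {H} (A B : H -> H) : Prop := positive_op (B \- A).

Definition strictly_positive_op {H} : set (H -> H) :=
  [set A | positive_op A /\
     exists2 alpha : R, 0 < alpha & loewner_le (alpha \*: idfun) A].

Definition thompson_gauge {H} (A B : H -> H) : R :=
  inf [set lambda | 0 < lambda /\ loewner_le A (lambda \*: B)].

(* On the zero space the gauge is 0, and [ln 0 = 0] gives the expected
   distance 0 from its only operator to itself. *)
Definition thompson_dist {H} (A B : H -> H) : R :=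
  ln (Num.max (thompson_gauge A B) (thompson_gauge B A)).

End BoundedOperators.

Section SetValuedOperators.
Context {R : realType}.
Implicit Types H G K : hilbertType R.

Definition sv_fun {H G} (f : H -> G) : H -> set G := fun x => [set f x].

Definition sv_inv {H G} (M : H -> set G) : G -> set H :=
  fun y => [set x | M x y].

Definition sv_add {H G} (M N : H -> set G) : H -> set G :=
  fun x => [set y + z | y in M x & z in N x].

Definition sv_comp {H G K} (N : G -> set K) (M : H -> set G) : H -> set K :=
  fun x => \bigcup_(y in M x) N y.

(* The parallel composition of [M] by the adjoint of [L]; it is parametrised by
   [L] rather than by its adjoint. *)
Definition parallel_comp {H G} (L : H -> G) (M : G -> set G) : H -> set H :=
  sv_inv (sv_comp (sv_fun (adjoint L)) (sv_comp (sv_inv M) (sv_fun L))).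

Definition resolvent_comp {H G} (L : H -> G) (gamma : R) (M : G -> set G) :
    H -> set H :=
  sv_add (parallel_comp L (sv_add M (sv_fun (gamma^-1 \*: idfun))))
         (sv_fun ((- gamma^-1) \*: idfun)).

Definition resolvent_cocomp {H G} (L : H -> G) (gamma : R) (M : G -> set G) :
    H -> set H :=
  sv_inv (resolvent_comp L gamma^-1 (sv_inv M)).

End SetValuedOperators.

(* Main.v *)
(* Write [C = B + gamma^-1 Id] and [P = (L^* C^-1 L)^-1]. The point
   [y0 = C^-1 L P x] satisfies [L^* y0 = x], and [C y0 = L P x] makes it the
   minimizer of [<C y, y>] over [{y | L^* y = x}], with minimum [<P x, x>].
   Hence the resolvent composition is the operator with quadratic form
     [q_B x = min {<B y, y> + gamma^-1 (|y|^2 - |x|^2) | L^* y = x}].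
   As [|L| <= 1], the term in [gamma^-1] is nonnegative, so for [l >= 1]
   [A <= l B] implies [q_A <= l q_B]; this bounds the Thompson distance.
   The cocomposition follows because inversion maps [A <= l B] to
   [B^-1 <= l A^-1]. *)
Require Import Defs.
From mathcomp Require Import all_boot all_order all_algebra.
From mathcomp Require Import all_classical all_reals all_analysis.
From mathcomp Require Import ring lra.

Set Implicit Arguments.
Unset Strict Implicit.
Unset Printing Implicit Defensive.

Import Order.TTheory GRing.Theory Num.Theory.
Import numFieldNormedType.Exports.
Local Open Scope classical_set_scope.
Local Open Scope ring_scope.

(** * Inner product calculus, the Cauchy-Schwarz inequality and Riesz representation *)

Section Inner.
Context {R : realType}.
Implicit Types H G K : hilbertType R.

Lemma innerDl H (x y z : H) : inner (x + y) z = inner x z + inner y z.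
Proof. exact: linearDl. Qed.

Lemma innerBl H (x y z : H) : inner (x - y) z = inner x z - inner y z.
Proof. exact: linearBl. Qed.

Lemma innerZl H a (x z : H) : inner (a *: x) z = a * inner x z.
Proof. exact: linearZl_LR. Qed.

Lemma innerC H (x y : H) : inner x y = inner y x.
Proof. by rewrite (hermC inner) /= expr0 mul1r. Qed.

Lemma innerDr H (x y z : H) : inner z (x + y) = inner z x + inner z y.
Proof. by rewrite !(innerC z) innerDl. Qed.

Lemma innerBr H (x y z : H) : inner z (x - y) = inner z x - inner z y.
Proof. by rewrite !(innerC z) innerBl. Qed.

Lemma innerZr H a (x z : H) : inner z (a *: x) = a * inner z x.
Proof. by rewrite !(innerC z) innerZl. Qed.

Definition innerE :=
  (@innerBl, @innerBr, @innerDl, @innerDr, @innerZl, @innerZr, @sqr_normE).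

(** For [a > 0] the polynomial is evaluated at its vertex [- b / a]; for [a = 0] a nonnegative
    affine function has slope zero. *)
Lemma quadratic_discr (a b c : R) : 0 <= a ->
  (forall t, 0 <= a * t ^+ 2 + 2 * b * t + c) -> b ^+ 2 <= a * c.
Proof.
rewrite le_eqVlt => /predU1P[<-|a0] h.
- have [->|b0] := eqVneq b 0; first by rewrite expr0n mul0r.
  (* At this point the affine function would take the value -1. *)
  have := h (- (c + 1) / (2 * b)).
  have -> : 2 * b * (- (c + 1) / (2 * b)) = - (c + 1) by field.
  lra.
- have := h (- b / a); rewrite -(ler_pM2l a0) mulr0.
  have -> : a * (a * (- b / a) ^+ 2 + 2 * b * (- b / a) + c)
            = a * c - b ^+ 2 by field; rewrite gt_eqF.
  by rewrite subr_ge0.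
Qed.

Lemma cauchy_schwarz_sqr H (x y : H) : inner x y ^+ 2 <= `|x| ^+ 2 * `|y| ^+ 2.
Proof.
apply: quadratic_discr; first exact: exprn_ge0.
move=> t; suff -> : `|x| ^+ 2 * t ^+ 2 + 2 * inner x y * t + `|y| ^+ 2 =
  `|t *: x + y| ^+ 2 by exact: exprn_ge0.
by rewrite !innerE (innerC y x); ring.
Qed.

Lemma cauchy_schwarz H (x y : H) : inner x y <= `|x| * `|y|.
Proof.
apply: le_trans (ler_norm _) _.
by rewrite -ler_sqr ?nnegrE ?mulr_ge0// exprMn real_normK ?num_real//
  cauchy_schwarz_sqr.
Qed.

Lemma inner_inj H (x y : H) : (forall z, inner z x = inner z y) -> x = y.
Proof.
move=> h; apply/subr0_eq/eqP; rewrite -normr_eq0 -sqrf_eq0 sqr_normE.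
by rewrite innerBr h subrr.
Qed.

(* The representing vector is the minimizer of [|x| ^ 2 - 2 f x]; minimizing
   sequences are Cauchy by the parallelogram identity. *)
Lemma riesz_representation H (f : H -> R) (C : R) :
  scalar f -> (forall x, `|f x| <= C * `|x|) ->
  exists p, forall x, f x = inner x p.
Proof.
move=> flin fC; pose J x := `|x| ^+ 2 - 2 * f x.
have fZ a x : f (a *: x) = a * f x by exact: (scalable_linear flin).
have fD x y : f (x + y) = f x + f y.
  by rewrite -[x]scale1r flin mul1r scale1r.
have JC x : - C ^+ 2 <= J x.
  have := fC x; rewrite ler_norml => /andP[_ fx].
  have := sqr_ge0 (`|x| - C); rewrite /J; nra.
pose m := inf (range J).
have hm : has_inf (range J).
  by split; [exists (J 0), 0|exists (- C ^+ 2) => _ [x _ <-]; exact: JC].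
have mJ x : m <= J x by apply: ge_inf; [exact: hm.2|exists x].
have /choice[u uJ] : forall n : nat, exists x, J x < m + n.+1%:R^-1.
  move=> n; have n0 : 0 < n.+1%:R^-1 :> R by rewrite invr_gt0.
  by have [_ [x _ <-]] := inf_adherent n0 hm; exists x.
(* Comparing [m] with [J] at the midpoint of [u n] and [u k] gives the parallelogram estimate. *)
have uu n k : `|u n - u k| ^+ 2 <= 2 * (n.+1%:R^-1 + k.+1%:R^-1).
  have := mJ (2^-1 *: (u n + u k)); have := uJ n; have := uJ k.
  rewrite /J fZ fD !innerE !(innerC (u k) (u n)).
  by move: n.+1%:R^-1 k.+1%:R^-1 => dn dk; lra.
have /cauchy_cvgP/cvg_ex[p up] : cauchy (u @ \oo).
  apply: cauchy_exP => e e0.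
  have e20 : 0 < e ^+ 2 / 4 by rewrite divr_gt0// exprn_gt0.
  have [N _ hN] := near_infty_natSinv_lt (PosNum e20).
  exists (u N), N => // n /= Nn; rewrite -ball_normE /=.
  rewrite -ltr_sqr ?nnegrE ?(ltW e0)//.
  apply: le_lt_trans (uu _ _) _.
  have := hN N (leqnn N); have := hN n Nn; rewrite /=.
  by move: n.+1%:R^-1 N.+1%:R^-1 => dn dN; lra.
exists p => x; apply/eqP; rewrite -subr_eq0 -sqrf_eq0 eq_le sqr_ge0 andbT.
(* An approximate Euler equation: [m <= J (t *: x + u n)] and [J (u n) < m + n.+1%:R^-1] make a
   quadratic in [t] nonnegative, and its discriminant gives the bound. *)
have ux n : (inner x (u n) - f x) ^+ 2 <= `|x| ^+ 2 * n.+1%:R^-1.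
  apply: quadratic_discr; first exact: exprn_ge0.
  move=> t; have := mJ (t *: x + u n); have := uJ n.
  rewrite /J fD fZ !innerE !(innerC (u n) x).
  by move: n.+1%:R^-1 => dn; nra.
apply/ler_addgt0Pl => e e0; rewrite addr0.
(* The two errors below add up to at most [4 * |x| ^ 2 * d <= e]; the summand 1 keeps the
   denominator positive when [x = 0]. *)
pose d := e / (4 * (`|x| ^+ 2 + 1)).
have x0 : 0 < 4 * (`|x| ^+ 2 + 1).
  by have := sqr_ge0 `|x|; lra.
have d0 : 0 < d by rewrite divr_gt0.
have de : 4 * (`|x| ^+ 2 + 1) * d = e by rewrite /d; field; rewrite gt_eqF.
near \oo => n.
have dn : n.+1%:R^-1 < d.
  by near: n; exact: (near_infty_natSinv_lt (PosNum d0)).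
have pn : `|p - u n| ^+ 2 < d.
  rewrite -[d]sqr_sqrtr ?(ltW d0)// ltr_sqr ?nnegrE ?sqrtr_ge0//.
  near: n; move/cvgrPdist_lt : up; apply; by rewrite sqrtr_gt0.
have := ux n; have := cauchy_schwarz_sqr x (p - u n).
rewrite innerBr => h1 h2.
set a := inner x p in h1 h2 *; set b := inner x (u n) in h1 h2 *.
have : (f x - a) ^+ 2 <= 2 * ((a - b) ^+ 2 + (b - f x) ^+ 2).
  by have := sqr_ge0 (a - b - (b - f x)); lra.
have x20 : 0 <= `|x| ^+ 2 by exact: exprn_ge0.
have := le_trans h1 (ler_wpM2l x20 (ltW pn)).
have := le_trans h2 (ler_wpM2l x20 (ltW dn)).
have := ltW d0; lra.
Unshelve. all: end_near. Qed.

End Inner.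

(** * Bounded operators, adjoints and coercivity *)

Section BoundedOps.
Context {R : realType}.
Implicit Types H G K : hilbertType R.

Lemma linear_opB H G (L : H -> G) : linear L -> {morph L : x y / x - y}.
Proof. exact: zmod_morphism_linear. Qed.

Lemma linear_opZ H G (L : H -> G) a x : linear L -> L (a *: x) = a *: L x.
Proof. by move=> Llin; exact: (scalable_linear Llin). Qed.

Lemma bounded_opP H G (L : H -> G) :
  bounded_op L -> exists2 M : R, 0 < M & forall x, `|L x| <= M * `|x|.
Proof.
move=> [_ [M LM]]; exists (`|M| + 1); first by rewrite ltr_wpDl.
move=> x; apply: le_trans (LM x) _; apply: ler_wpM2r => //.
by rewrite (le_trans (ler_norm M))// lerDl.
Qed.

Lemma bounded_op_comp H G K (L : H -> G) (N : G -> K) :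
  bounded_op L -> bounded_op N -> bounded_op (N \o L).
Proof.
move=> bL bN; split; first by move=> a x y /=; rewrite bL.1 bN.1.
have [M _ LM] := bounded_opP bL; have [M' M'0 NM'] := bounded_opP bN.
exists (M' * M) => x /=; rewrite (le_trans (NM' _))// -mulrA.
by rewrite ler_pM2l.
Qed.

Lemma bounded_opD H G (L N : H -> G) :
  bounded_op L -> bounded_op N -> bounded_op (L \+ N).
Proof.
move=> [Llin [M LM]] [Nlin [M' NM']]; split.
  by move=> a x y /=; rewrite Llin Nlin scalerDr addrACA.
exists (M + M') => x /=; rewrite (le_trans (ler_normD _ _))// mulrDl.
exact: lerD.
Qed.

Lemma bounded_opZ H G (L : H -> G) (a : R) :
  bounded_op L -> bounded_op (a \*: L).
Proof.
move=> [Llin [M LM]]; split.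
  by move=> b x y /=; rewrite Llin scalerDr !scalerA mulrC.
exists (`|a| * M) => x /=; rewrite normrZ -mulrA; exact: ler_wpM2l.
Qed.

Lemma bounded_opB H G (L N : H -> G) :
  bounded_op L -> bounded_op N -> bounded_op (L \- N).
Proof.
move=> bL bN; have -> : L \- N = L \+ (-1) \*: N.
  by apply/funext => x /=; rewrite scaleN1r.
by apply: bounded_opD => //; exact: bounded_opZ.
Qed.

Lemma bounded_op_id H : bounded_op (@idfun H).
Proof. by split; [|exists 1 => x; rewrite mul1r]. Qed.

(** Riesz representation of [u |-> inner (L u) y] shows that the choice in [adjoint] picks a
    representing vector and not the default 0. *)
Lemma adjointP H G (L : H -> G) x y :
  bounded_op L -> inner (L x) y = inner x (adjoint L y).
Proof.
move=> bL; have [M M0 LM] := bounded_opP bL.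
suff [z Lz] : exists z, forall x, inner (L x) y = inner x z.
  by move: x; rewrite /adjoint; case: xgetP => [z' _ //|/(_ z)].
apply: (@riesz_representation _ _ _ (M * `|y|)).
  by move=> a u v; rewrite bL.1 innerDl innerZl.
move=> u; rewrite -ler_sqr ?nnegrE// ?mulr_ge0// ?(ltW M0)//.
rewrite real_normK ?num_real// (le_trans (cauchy_schwarz_sqr _ _))//.
rewrite -exprMn ler_sqr ?nnegrE ?mulr_ge0 ?(ltW M0)//.
by rewrite mulrAC ler_wpM2r.
Qed.

Lemma adjoint_eq H G (L : H -> G) (N : G -> H) : bounded_op L ->
  (forall x y, inner (L x) y = inner x (N y)) -> adjoint L = N.
Proof.
move=> bL LN; apply/funext => y; apply: inner_inj => x.
by rewrite -adjointP.
Qed.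

(** With [z = adjoint L y], [|z| ^ 2 = inner (L z) y <= M * |z| * |y|]; then [|z|] is cancelled. *)
Lemma adjoint_bounded H G (L : H -> G) : bounded_op L -> bounded_op (adjoint L).
Proof.
move=> bL; have [M M0 LM] := bounded_opP bL; split.
  move=> a x y; apply: inner_inj => z.
  by rewrite -adjointP// !innerE -!adjointP.
exists M => y; have [->|y0] := eqVneq (adjoint L y) 0.
  by rewrite normr0 mulr_ge0// ltW.
have z0 : 0 < `|adjoint L y| by rewrite normr_gt0.
rewrite -(ler_pM2r z0) -expr2 sqr_normE -adjointP//.
rewrite (le_trans (cauchy_schwarz _ _))// mulrAC ler_wpM2r//.
Qed.

(** A nonzero [x] is rescaled to norm 1; boundedness of [L] makes the supremum in [opnorm] an actual
    upper bound. *)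
Lemma opnorm_le H G (L : H -> G) x :
  bounded_op L -> `|L x| <= opnorm L * `|x|.
Proof.
move=> bL; have [M M0 LM] := bounded_opP bL.
have [->|x0] := eqVneq x 0.
  by rewrite normr0 mulr0 (le_trans (LM _))// normr0 mulr0.
have nx0 : 0 < `|x| by rewrite normr_gt0.
rewrite -ler_pdivrMr//.
have -> : `|L x| / `|x| = `|L (`|x|^-1 *: x)|.
  rewrite (linear_opZ _ _ bL.1) normrZ normrV ?unitfE ?gt_eqF// normr_id.
  by rewrite mulrC.
apply: ub_le_sup; last first.
  exists (`|x|^-1 *: x) => //=.
  by rewrite normrZ normrV ?unitfE ?gt_eqF// normr_id mulVf ?gt_eqF.
exists M => _ [z /= z1 <-]; rewrite (le_trans (LM _))//.
by rewrite ler_piMr// ltW.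
Qed.

Lemma adjoint_contraction H G (L : H -> G) y : bounded_op L ->
  (forall x, `|L x| <= `|x|) -> `|adjoint L y| <= `|y|.
Proof.
move=> bL L1; have [->|y0] := eqVneq (adjoint L y) 0; first by rewrite normr0.
have z0 : 0 < `|adjoint L y| by rewrite normr_gt0.
rewrite -(ler_pM2l z0) -expr2 sqr_normE -adjointP//.
by rewrite (le_trans (cauchy_schwarz _ _))// ler_wpM2r.
Qed.

(** * The Loewner order through quadratic forms *)

Definition symmetric_op H (A : H -> H) :=
  forall x y, inner (A x) y = inner x (A y).

Lemma adjoint_id_symmetric H (A : H -> H) : bounded_op A ->
  adjoint A = A <-> symmetric_op A.
Proof.
move=> bA; split=> [AA x y|]; last exact: adjoint_eq.
by rewrite -[in RHS]AA -adjointP.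
Qed.

Lemma loewner_leP H (A B : H -> H) :
  bounded_op A -> symmetric_op A -> bounded_op B -> symmetric_op B ->
  loewner_le A B <-> forall x, inner (A x) x <= inner (B x) x.
Proof.
move=> bA sA bB sB; split=> [[_ _ AB] x|AB].
  by have := AB x; rewrite /= innerBl subr_ge0.
have bBA := bounded_opB bB bA; split=> //.
  by apply/adjoint_id_symmetric => // x y /=; rewrite innerBl innerBr sA sB.
by move=> x; rewrite /= innerBl subr_ge0.
Qed.

Lemma symmetric_opZ H (a : R) (A : H -> H) :
  symmetric_op A -> symmetric_op (a \*: A).
Proof. by move=> sA x y /=; rewrite innerZl innerZr sA. Qed.

Lemma symmetric_opD H (A B : H -> H) :
  symmetric_op A -> symmetric_op B -> symmetric_op (A \+ B).
Proof. by move=> sA sB x y /=; rewrite innerDl innerDr sA sB. Qed.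

(** Strict positivity as coercivity of the quadratic form, the shape used in all later estimates. *)
Lemma strictly_positive_opP H (A : H -> H) :
  strictly_positive_op A <-> [/\ bounded_op A, symmetric_op A &
    exists2 alpha : R, 0 < alpha &
      forall x, alpha * `|x| ^+ 2 <= inner (A x) x].
Proof.
have bI (a : R) : bounded_op (a \*: @idfun H).
  exact/bounded_opZ/bounded_op_id.
have sI (a : R) : symmetric_op (a \*: @idfun H) by exact: symmetric_opZ.
split=> [[[bA aA _] [a a0 aleA]]|[bA sA [a a0 aA]]].
  have sA : symmetric_op A by apply/adjoint_id_symmetric.
  split=> //; exists a => // x.
  have := (loewner_leP (bI a) (sI a) bA sA).1 aleA x.
  by rewrite /= innerZl -sqr_normE.
split; last first.
  by exists a => //; apply/loewner_leP => // x; rewrite /= innerZl -sqr_normE.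
split=> //; first exact/adjoint_id_symmetric.
by move=> x; rewrite (le_trans _ (aA x))// mulr_ge0 ?exprn_ge0// ltW.
Qed.

Lemma strictly_positive_op_bounded H (A : H -> H) :
  strictly_positive_op A -> bounded_op A.
Proof. by move=> [[]]. Qed.

Lemma strictly_positive_op_addZid H (A : H -> H) (c : R) : 0 <= c ->
  strictly_positive_op A -> strictly_positive_op (A \+ c \*: idfun).
Proof.
move=> c0 /strictly_positive_opP[bA sA [a a0 aA]]; apply/strictly_positive_opP.
split.
- by apply: bounded_opD => //; exact/bounded_opZ/bounded_op_id.
- by apply: symmetric_opD => //; exact: symmetric_opZ.
exists a => // x /=; rewrite innerDl innerZl (le_trans (aA x))// lerDl.
by rewrite mulr_ge0// -sqr_normE exprn_ge0.
Qed.

(** Coercivity is inherited through [inner (C (L x)) (L x) >= a * |L x| ^ 2 >= a * b ^ 2 * |x| ^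
    2]. *)
Lemma strictly_positive_op_conj H G (L : H -> G) (C : G -> G) :
  bounded_op L -> bounded_below L -> strictly_positive_op C ->
  strictly_positive_op (adjoint L \o (C \o L)).
Proof.
move=> bL [b b0 bleL] /strictly_positive_opP[bC sC [a a0 aC]].
apply/strictly_positive_opP; split.
- apply: bounded_op_comp; first exact: bounded_op_comp.
  exact: adjoint_bounded.
- move=> x y /=; rewrite -adjointP// -sC innerC -adjointP// innerC.
  by rewrite innerC.
exists (a * b ^+ 2); first by rewrite mulr_gt0// exprn_gt0.
move=> x /=; rewrite innerC -adjointP// innerC (le_trans _ (aC _))//.
rewrite -mulrA -exprMn ler_wpM2l ?(ltW a0)// ler_sqr ?nnegrE//.
by rewrite mulr_ge0// ltW.
Qed.

(* Contraction principle for [x |-> x - t (C x - y)] with [t] small. *)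
Lemma strictly_positive_op_surj H (C : H -> H) y :
  strictly_positive_op C -> exists x, C x = y.
Proof.
move=> /strictly_positive_opP[bC _ [a a0 aC]].
(* Adding [a] to the bound [M0] ensures [a < M], hence [s <= 1] below. *)
have [M0 M00 CM0] := bounded_opP bC; pose M := M0 + a.
have M1 : 0 < M by exact: addr_gt0.
have CM x : `|C x| <= M * `|x|.
  by rewrite (le_trans (CM0 x))// ler_wpM2r// lerDl ltW.
(* This [t] minimizes [1 - 2 * t * a + t ^ 2 * M ^ 2], with minimum [1 - s]. The Lipschitz constant
   [1 - s / 2] suffices because [1 - s <= (1 - s / 2) ^ 2]. *)
pose t := a / M ^+ 2; pose s := (a / M) ^+ 2.
have M20 : 0 < M ^+ 2 by exact: exprn_gt0.
have t0 : 0 < t by exact: divr_gt0.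
have s0 : 0 < s by rewrite exprn_gt0// divr_gt0.
have s1 : s <= 1.
  by rewrite expr_le1// ?divr_ge0 ?ltW// ltr_pdivrMr// mul1r ltrDr.
have contr x : `|x - t *: C x| <= (1 - s / 2) * `|x|.
  have s20 : 0 <= 1 - s / 2 by lra.
  rewrite -ler_sqr ?nnegrE ?mulr_ge0// exprMn.
  have -> : `|x - t *: C x| ^+ 2 =
      `|x| ^+ 2 - 2 * t * inner (C x) x + t ^+ 2 * `|C x| ^+ 2.
    by rewrite !innerE (innerC x (C x)); ring.
  have h1 : t * (a * `|x| ^+ 2) <= t * inner (C x) x by rewrite ler_pM2l.
  have h2 : t ^+ 2 * `|C x| ^+ 2 <= t ^+ 2 * (M * `|x|) ^+ 2.
    rewrite ler_pM2l; last exact: exprn_gt0.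
    by rewrite ler_sqr ?nnegrE ?mulr_ge0// ltW.
  have h3 : t * (a * `|x| ^+ 2) = s * `|x| ^+ 2.
    by rewrite /t /s; field; rewrite gt_eqF.
  have h4 : t ^+ 2 * (M * `|x|) ^+ 2 = s * `|x| ^+ 2.
    by rewrite /t /s; field; rewrite gt_eqF.
  have h5 : 0 <= (s / 2) ^+ 2 * `|x| ^+ 2 by rewrite mulr_ge0 ?sqr_ge0.
  move: h1 h2 h5; rewrite h3 h4 {h3 h4}.
  move: (inner _ _) (`|x| ^+ 2) (`|C x| ^+ 2) => u v w; lra.
pose f x := x - t *: C x + t *: y.
have q0 : 0 <= 1 - s / 2 by lra.
have fU : {homo f : x / setT x} by [].
have [||p _ fp] := @banach_fixed_point R H setT (mkfun_fun fU) _ closedT.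
- exists (NngNum q0); split=> /=; first by lra.
  move=> [u v] _ /=; rewrite /mkfun /f.
  rewrite opprD addrACA subrr addr0.
  have -> : u - t *: C u - (v - t *: C v) = (u - v) - t *: C (u - v).
    by rewrite (linear_opB bC.1) scalerBr !opprB addrACA [RHS]addrACA
      (addrC (- v)).
  exact: contr.
- by exists 0.
exists p; apply/(scalerI (lt0r_neq0 t0))/esym/eqP; rewrite -subr_eq0; apply/eqP.
have /(congr1 (fun z => z - p)) := fp; rewrite subrr /mkfun /f.
by rewrite addrAC -addrA addrACA subrr add0r addrC => ->.
Qed.
End BoundedOps.

(** * Inverses of strictly positive operators *)

Section Inverse.
Context {R : realType}.
Implicit Types H G K : hilbertType R.

(** A total function by choice; for strictly positive [C] surjectivity rules out the default 0. *)
Definition op_inv H (C : H -> H) : H -> H := fun y => xget 0 [set x | C x = y].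

Lemma op_invK H (C : H -> H) : strictly_positive_op C -> cancel (op_inv C) C.
Proof.
move=> pC y; rewrite /op_inv; case: xgetP => [x _ //|].
by have [x Cx] := strictly_positive_op_surj y pC => /(_ x).
Qed.

Lemma strictly_positive_op_inj H (C : H -> H) :
  strictly_positive_op C -> injective C.
Proof.
move=> /strictly_positive_opP[[Clin _] _ [a a0 aC]] x y Cxy.
apply/eqP; rewrite -subr_eq0 -normr_eq0 -sqrf_eq0 eq_le sqr_ge0 andbT.
have := aC (x - y); rewrite (linear_opB Clin) Cxy subrr.
by rewrite -(scale0r (x - y)) innerZl mul0r pmulr_rle0.
Qed.

Lemma op_invKV H (C : H -> H) : strictly_positive_op C -> cancel C (op_inv C).
Proof.
by move=> pC x; apply: (strictly_positive_op_inj pC); rewrite op_invK.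
Qed.

(** For [y = C x], [a * |x| ^ 2 <= inner y x <= |y| * |x|] bounds the inverse by [a^-1], and
    [|y| <= M * |x|] turns [a * |x| ^ 2] into the lower bound [a / M ^ 2 * |y| ^ 2]. *)
Lemma op_inv_strictly_positive H (C : H -> H) :
  strictly_positive_op C -> strictly_positive_op (op_inv C).
Proof.
move=> pC; have [bC sC [a a0 aC]] := (strictly_positive_opP C).1 pC.
have [M M0 CM] := bounded_opP bC.
apply/strictly_positive_opP; split.
- split.
    move=> c x y; apply: (strictly_positive_op_inj pC).
    by rewrite bC.1 !op_invK.
  exists a^-1 => y; set x := op_inv C y.
  have [->|x0] := eqVneq x 0; first by rewrite normr0 mulr_ge0// invr_ge0 ltW.
  have nx0 : 0 < `|x| by rewrite normr_gt0.
  rewrite mulrC ler_pdivlMr// -(ler_pM2r nx0) mulrAC -expr2 mulrC.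
  by rewrite (le_trans (aC x))// op_invK// cauchy_schwarz.
- by move=> x y; rewrite -{2}(op_invK pC x) sC op_invK.
exists (a / M ^+ 2); first by rewrite divr_gt0// exprn_gt0.
move=> y; set x := op_inv C y; have := aC x; rewrite op_invK// innerC.
apply: le_trans.
rewrite mulrAC ler_pdivrMr ?exprn_gt0// -mulrA ler_pM2l// -exprMn.
rewrite ler_sqr ?nnegrE// ?mulr_ge0// ?(ltW M0)//.
by rewrite -(op_invK pC y) mulrC.
Qed.

(** Let [u] and [v] be the preimages of [x] under [A] and [B]. Expand the form of [A] at
    [l *: u - v], which is nonnegative, and bound [inner (A v) v] by [l * inner x v]. *)
Lemma op_inv_antitone H (A B : H -> H) (l : R) : 0 < l ->
  strictly_positive_op A -> strictly_positive_op B ->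
  (forall x, inner (A x) x <= l * inner (B x) x) ->
  forall x, inner (op_inv B x) x <= l * inner (op_inv A x) x.
Proof.
move=> l0 pA pB AB x.
have [bA sA [a a0 aA]] := (strictly_positive_opP A).1 pA.
pose u := op_inv A x; pose v := op_inv B x.
have : 0 <= inner (A (l *: u - v)) (l *: u - v).
  by rewrite (le_trans _ (aA _))// mulr_ge0 ?sqr_ge0 ?ltW.
rewrite (linear_opB bA.1) (linear_opZ _ _ bA.1) !innerE.
rewrite (sA v u) /u !op_invK// -/u => h.
have := AB v; rewrite /v op_invK// -/v => Av.
rewrite -(ler_pM2l l0) -subr_ge0.
move: h; rewrite (innerC x u) (innerC x v) in Av *; lra.
Qed.

(** * Parallel composition as a constrained minimum *)

Definition parallel_op H G (L : H -> G) (C : G -> G) : H -> H :=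
  op_inv (adjoint L \o (op_inv C \o L)).

Lemma parallel_op_strictly_positive H G (L : H -> G) (C : G -> G) :
  bounded_op L -> bounded_below L -> strictly_positive_op C ->
  strictly_positive_op (parallel_op L C).
Proof.
move=> bL bleL pC; apply: op_inv_strictly_positive.
by apply: strictly_positive_op_conj => //; exact: op_inv_strictly_positive.
Qed.

Section ParallelVariational.
Variables (H G : hilbertType R) (L : H -> G) (C : G -> G) (x : H).
Hypotheses (bL : bounded_op L) (bleL : bounded_below L).
Hypothesis pC : strictly_positive_op C.

Let y0 := op_inv C (L (parallel_op L C x)).

Let adj_y0 : adjoint L y0 = x.
Proof.
rewrite -[in RHS](@op_invK _ (adjoint L \o (op_inv C \o L)) _ x)//.
by apply: strictly_positive_op_conj => //; exact: op_inv_strictly_positive.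
Qed.

(** The Lagrange condition at [y0]: the form [inner (C y0) y] depends on [y] only through the
    constraint value [adjoint L y]. *)
Let inner_y0 y : inner (C y0) y = inner (parallel_op L C x) (adjoint L y).
Proof. by rewrite op_invK// adjointP. Qed.

Lemma parallel_op_attained :
  exists2 y, adjoint L y = x & inner (parallel_op L C x) x = inner (C y) y.
Proof. by exists y0 => //; rewrite inner_y0 adj_y0. Qed.

(** In the expansion of the nonnegative form of [C] at [y - y0], the cross terms and the [y0] term
    all reduce to [inner (parallel_op L C x) x]. *)
Lemma parallel_op_min y : adjoint L y = x ->
  inner (parallel_op L C x) x <= inner (C y) y.
Proof.
move=> yx; have [bC sC [a a0 aC]] := (strictly_positive_opP C).1 pC.
have : 0 <= inner (C (y - y0)) (y - y0).
  by rewrite (le_trans _ (aC _))// mulr_ge0 ?sqr_ge0 ?ltW.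
rewrite (linear_opB bC.1) !innerE (sC y y0) (innerC y) !inner_y0 adj_y0 yx; lra.
Qed.

End ParallelVariational.

(** * The resolvent composition as an operator and its monotonicity *)

Definition resolvent_op H G (L : H -> G) (gamma : R) (B : G -> G) : H -> H :=
  parallel_op L (B \+ gamma^-1 \*: idfun) \+ (- gamma^-1) \*: idfun.

Section Resolvent.
Variables (H G : hilbertType R) (L : H -> G) (gamma : R).
Hypotheses (bL : bounded_op L) (bleL : bounded_below L).
Hypotheses (L1 : forall x, `|L x| <= `|x|) (gamma0 : 0 < gamma).

Let gV0 : 0 <= gamma^-1. Proof. by rewrite invr_ge0 ltW. Qed.

Let resolvent_opE B x : inner (resolvent_op L gamma B x) x =
  inner (parallel_op L (B \+ gamma^-1 \*: idfun) x) x - gamma^-1 * `|x| ^+ 2.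
Proof. by rewrite /= innerDl innerZl mulNr -sqr_normE. Qed.

Let adj_le y x : adjoint L y = x -> `|x| ^+ 2 <= `|y| ^+ 2.
Proof. by move=> <-; rewrite ler_sqr ?nnegrE// adjoint_contraction. Qed.

Lemma resolvent_op_attained B x : strictly_positive_op B ->
  exists2 y, adjoint L y = x & inner (resolvent_op L gamma B x) x =
    inner (B y) y + gamma^-1 * (`|y| ^+ 2 - `|x| ^+ 2).
Proof.
move=> pB; have pC := strictly_positive_op_addZid gV0 pB.
have [y yx Py] := parallel_op_attained x bL bleL pC.
exists y => //; rewrite resolvent_opE Py /= innerDl innerZl -sqr_normE; ring.
Qed.

Lemma resolvent_op_min B x y : strictly_positive_op B -> adjoint L y = x ->
  inner (resolvent_op L gamma B x) x <=
    inner (B y) y + gamma^-1 * (`|y| ^+ 2 - `|x| ^+ 2).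
Proof.
move=> pB yx; have pC := strictly_positive_op_addZid gV0 pB.
have := parallel_op_min bL bleL pC yx.
rewrite resolvent_opE /= innerDl innerZl -sqr_normE; lra.
Qed.

(** The coercivity constant [a] of [B] is kept: at the minimizer [y] the form is at least
    [a * |y| ^ 2], and [|x| <= |y|]. *)
Lemma resolvent_op_strictly_positive B : strictly_positive_op B ->
  strictly_positive_op (resolvent_op L gamma B).
Proof.
move=> pB; have pC := strictly_positive_op_addZid gV0 pB.
have /strictly_positive_opP[bP sP _] :=
  parallel_op_strictly_positive bL bleL pC.
have /strictly_positive_opP[_ _ [a a0 aB]] := pB.
apply/strictly_positive_opP; split.
- by apply: bounded_opD => //; exact/bounded_opZ/bounded_op_id.
- by apply: symmetric_opD => //; exact: symmetric_opZ.
exists a => // x; have [y yx ->] := resolvent_op_attained x pB.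
have xy := adj_le yx.
have h1 : 0 <= gamma^-1 * (`|y| ^+ 2 - `|x| ^+ 2).
  by rewrite mulr_ge0// subr_ge0.
apply: ler_wpDr => //; rewrite (le_trans _ (aB y))//.
by rewrite ler_pM2l.
Qed.

(** The minimizer for [B] serves as a competitor in the problem for [A]. *)
Lemma resolvent_op_le A B l : 1 <= l ->
  strictly_positive_op A -> strictly_positive_op B ->
  (forall y, inner (A y) y <= l * inner (B y) y) ->
  forall x, inner (resolvent_op L gamma A x) x <=
    l * inner (resolvent_op L gamma B x) x.
Proof.
move=> l1 pA pB AB x; have [y yx ->] := resolvent_op_attained x pB.
apply: le_trans (resolvent_op_min pA yx) _.
rewrite [leRHS]mulrDr lerD//.
have h1 : 0 <= gamma^-1 * (`|y| ^+ 2 - `|x| ^+ 2).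
  by rewrite mulr_ge0// subr_ge0 (adj_le yx).
by rewrite ler_peMl.
Qed.

End Resolvent.

(** * From set-valued to single-valued operators *)

Lemma sv_inv_fun H (C : H -> H) : strictly_positive_op C ->
  sv_inv (sv_fun C) = sv_fun (op_inv C).
Proof.
move=> pC; apply/funext => y; rewrite /sv_inv /sv_fun; apply/seteqP.
by split=> x /= => [->|->]; rewrite ?op_invK ?op_invKV.
Qed.

Lemma sv_add_fun H G (f g : H -> G) :
  sv_add (sv_fun f) (sv_fun g) = sv_fun (f \+ g).
Proof.
apply/funext => x; apply/seteqP; split=> [z [_ -> [_ -> <-]] //|z ->].
by exists (f x) => //; exists (g x).
Qed.

Lemma sv_comp_fun H G K (g : G -> K) (f : H -> G) :
  sv_comp (sv_fun g) (sv_fun f) = sv_fun (g \o f).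
Proof. by apply/funext => x; rewrite /sv_comp /sv_fun bigcup_set1. Qed.

Lemma resolvent_comp_fun H G (L : H -> G) (gamma : R) (B : G -> G) :
  bounded_op L -> bounded_below L -> 0 < gamma -> strictly_positive_op B ->
  resolvent_comp L gamma (sv_fun B) = sv_fun (resolvent_op L gamma B).
Proof.
move=> bL bleL gamma0 pB; have gV0 : 0 <= gamma^-1 by rewrite invr_ge0 ltW.
have pC := strictly_positive_op_addZid gV0 pB.
rewrite /resolvent_comp /parallel_comp sv_add_fun (sv_inv_fun pC) !sv_comp_fun.
rewrite sv_inv_fun ?sv_add_fun//.
by apply: strictly_positive_op_conj => //; exact: op_inv_strictly_positive.
Qed.

(** * Gauges and the Thompson metric *)

Section Thompson.
Variables H G : hilbertType R.

Lemma strictly_positive_loewnerP K (A B : K -> K) (l : R) :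
  strictly_positive_op A -> strictly_positive_op B ->
  loewner_le A (l \*: B) <-> forall x, inner (A x) x <= l * inner (B x) x.
Proof.
move=> /strictly_positive_opP[bA sA _] /strictly_positive_opP[bB sB _].
have := loewner_leP bA sA (bounded_opZ l bB) (symmetric_opZ l sB).
by move=> ->; split=> AB x; have := AB x; rewrite /= innerZl.
Qed.

Lemma thompson_gauge_ge0 K (A B : K -> K) : 0 <= thompson_gauge A B.
Proof.
rewrite /thompson_gauge; set E := [set _ | _].
(* The infimum of the empty set is 0 by convention. *)
have [->|/set0P E0] := eqVneq E set0; first by rewrite inf0.
by apply: lb_le_inf => // l [/ltW].
Qed.

Lemma thompson_gauge_le K (A B : K -> K) (l : R) : 0 < l ->
  loewner_le A (l \*: B) -> thompson_gauge A B <= l.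
Proof. by move=> l0 AB; apply: ge_inf => //; exists 0 => k [/ltW]. Qed.

Lemma strictly_positive_inner_ge0 K (A : K -> K) x :
  strictly_positive_op A -> 0 <= inner (A x) x.
Proof. by case=> -[_ _]. Qed.

(** Some admissible [k < l] exists, and [k] may be enlarged to [l] because the form of [B] is
    nonnegative. *)
Lemma thompson_gauge_lt K (A B : K -> K) (l : R) :
  strictly_positive_op A -> strictly_positive_op B ->
  thompson_gauge A B < l -> loewner_le A (l \*: B).
Proof.
move=> pA pB; have /strictly_positive_opP[_ _ [b b0 bB]] := pB.
have [M M0 AM] := bounded_opP (strictly_positive_op_bounded pA).
have nE : [set l | 0 < l /\ loewner_le A (l \*: B)] !=set0.
  (* Admissible since [inner (A x) x <= M * |x| ^ 2] and [b * |x| ^ 2 <= inner (B x) x]. *)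
  exists (M / b); split; first exact: divr_gt0.
  apply/strictly_positive_loewnerP => // x.
  apply: le_trans (cauchy_schwarz _ _) _.
  apply: le_trans (ler_wpM2r (normr_ge0 _) (AM x)) _.
  have -> : M * `|x| * `|x| = M / b * (b * `|x| ^+ 2).
    by field; rewrite gt_eqF.
  by rewrite ler_pM2l// divr_gt0.
move=> /inf_lt[//|k [k0 /strictly_positive_loewnerP AkB] kl].
apply/strictly_positive_loewnerP => // x; apply: le_trans (AkB pA pB x) _.
by rewrite ler_wpM2r ?strictly_positive_inner_ge0// ltW.
Qed.

(** Any scalar [k] above both gauges gives [A <= k B <= k ^ 2 A], and testing at [x] forces
    [k ^ 2 >= 1]. *)
Lemma thompson_max_ge1 K (A B : K -> K) (x : K) : x != 0 ->
  strictly_positive_op A -> strictly_positive_op B ->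
  1 <= Num.max (thompson_gauge A B) (thompson_gauge B A).
Proof.
move=> x0 pA pB; apply/ler_addgt0Pr => e e0; set m := Num.max _ _.
have /strictly_positive_opP[_ _ [a a0 aA]] := pA.
have Ax : 0 < inner (A x) x.
  by rewrite (lt_le_trans _ (aA x))// mulr_gt0// exprn_gt0// normr_gt0.
have m0 : 0 <= m by rewrite le_max thompson_gauge_ge0.
have me : 0 < m + e by exact: ltr_wpDl.
have /(strictly_positive_loewnerP _ pA pB)/(_ x) AB :
    loewner_le A ((m + e) \*: B).
  apply: thompson_gauge_lt; rewrite // (le_lt_trans (y := m)) ?ltrDl//.
  by rewrite le_max lexx.
have /(strictly_positive_loewnerP _ pB pA)/(_ x) BA :
    loewner_le B ((m + e) \*: A).
  apply: thompson_gauge_lt; rewrite // (le_lt_trans (y := m)) ?ltrDl//.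
  by rewrite le_max lexx orbT.
have : inner (A x) x <= (m + e) ^+ 2 * inner (A x) x.
  by rewrite (le_trans AB)// expr2 -mulrA ler_pM2l.
by rewrite ler_pMl// expr_ge1// ltW.
Qed.

(** Every positive scalar is admissible on the zero space. *)
Lemma thompson_trivial K (A B : K -> K) : (forall x : K, x = 0) ->
  strictly_positive_op A -> strictly_positive_op B -> thompson_gauge A B = 0.
Proof.
move=> K0 pA pB; apply/eqP; rewrite eq_le thompson_gauge_ge0 andbT.
apply/ler_addgt0Pr => e e0; rewrite add0r.
apply: thompson_gauge_le => //; apply/strictly_positive_loewnerP => // x.
have z : forall u : K, inner u x = 0.
  by move=> u; rewrite (K0 x) innerC -(scale0r u) innerZl mul0r.
by rewrite !z mulr0.
Qed.

(* Only scalars [l >= 1] have to be tested, since the larger of the two gauges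
   is at least 1 on a nonzero space; on the zero space both distances are
   [ln 0 = 0]. *)
Lemma thompson_dist_le (A B : G -> G) (A' B' : H -> H) :
  ((exists x : H, x != 0) -> exists y : G, y != 0) ->
  strictly_positive_op A -> strictly_positive_op B ->
  strictly_positive_op A' -> strictly_positive_op B' ->
  (forall l, 1 <= l -> (forall y, inner (A y) y <= l * inner (B y) y) ->
    forall x, inner (A' x) x <= l * inner (B' x) x) ->
  (forall l, 1 <= l -> (forall y, inner (B y) y <= l * inner (A y) y) ->
    forall x, inner (B' x) x <= l * inner (A' x) x) ->
  thompson_dist A' B' <= thompson_dist A B.
Proof.
move=> HG pA pB pA' pB' AB BA; rewrite /thompson_dist.
have triv K (X Y : K -> K) : ~ (exists x : K, x != 0) ->
    strictly_positive_op X -> strictly_positive_op Y ->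
    Num.max (thompson_gauge X Y) (thompson_gauge Y X) = 0.
  move=> /forallNP K0 pX pY; rewrite !thompson_trivial ?maxxx//.
    by move=> x; apply/eqP/negPn/negP; exact: K0.
  by move=> x; apply/eqP/negPn/negP; exact: K0.
have [[x x0]|H0] := pselect (exists x : H, x != 0); last first.
  (* The left distance is [ln 0 = 0]; the right one is nonnegative whether or not [G] is zero. *)
  rewrite (triv _ _ _ H0)// ln0//.
  have [[y y0]|G0] := pselect (exists y : G, y != 0).
    by rewrite ln_ge0// (thompson_max_ge1 y0).
  by rewrite (triv _ _ _ G0)// ln0.
have [y y0] := HG (ex_intro _ x x0).
have m1 := thompson_max_ge1 y0 pA pB.
have m1' := thompson_max_ge1 x0 pA' pB'.
rewrite ler_ln ?posrE ?(lt_le_trans ltr01)//.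
set m := Num.max _ _ in m1 *.
(* The scalar [m + e] lies strictly above both gauges of [A] and [B], so both comparisons hold with
   it and transfer to [A'] and [B']. *)
apply/ler_addgt0Pr => e e0; have me : 1 <= m + e by rewrite ler_wpDr// ltW.
have me0 : 0 < m + e by rewrite (lt_le_trans ltr01).
rewrite ge_max; apply/andP; split; apply: thompson_gauge_le => //;
  apply/strictly_positive_loewnerP => //; [apply: AB|apply: BA] => //;
  apply/strictly_positive_loewnerP => //; apply: thompson_gauge_lt => //;
  by rewrite (le_lt_trans (y := m)) ?ltrDl// le_max lexx ?orbT.
Qed.

End Thompson.
End Inverse.

Theorem theorem4p1 (R : realType) (H G : hilbertType R) (L : H -> G)
    (gamma : R)
    (L_bounded : bounded_op L) (L_below : bounded_below L)
    (L_norm : opnorm L <= 1) (gamma_gt0 : 0 < gamma) :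
  (exists T : (G -> G) -> (H -> H),
     [/\ forall B : G -> G, strictly_positive_op B ->
           resolvent_cocomp L gamma (sv_fun B) = sv_fun (T B),
         forall B : G -> G, strictly_positive_op B ->
           strictly_positive_op (T B)
       & forall A B : G -> G,
           strictly_positive_op A -> strictly_positive_op B ->
           thompson_dist (T A) (T B) <= thompson_dist A B]) /\
  (exists T : (G -> G) -> (H -> H),
     [/\ forall B : G -> G, strictly_positive_op B ->
           resolvent_comp L gamma (sv_fun B) = sv_fun (T B),
         forall B : G -> G, strictly_positive_op B ->
           strictly_positive_op (T B)
       & forall A B : G -> G,
           strictly_positive_op A -> strictly_positive_op B ->
           thompson_dist (T A) (T B) <= thompson_dist A B]).
Proof.
have L1 x : `|L x| <= `|x|.
  by rewrite (le_trans (opnorm_le _ L_bounded))// ler_piMl.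
(* An operator bounded below sends nonzero vectors to nonzero vectors. *)
have HG : (exists x : H, x != 0) -> exists y : G, y != 0.
  move=> [x x0]; exists (L x); have [b b0 bL] := L_below.
  by rewrite -normr_gt0 (lt_le_trans _ (bL x))// mulr_gt0// normr_gt0.
have pR := resolvent_op_strictly_positive L_bounded L_below L1.
have gammaV0 : 0 < gamma^-1 by rewrite invr_gt0.
split.
- exists (fun B => op_inv (resolvent_op L gamma^-1 (op_inv B))).
  have pI (B : G -> G) : strictly_positive_op B ->
      strictly_positive_op (resolvent_op L gamma^-1 (op_inv B)).
    by move=> pB; apply: pR => //; exact: op_inv_strictly_positive.
  (* The inner and the outer inversion each swap the roles of [A] and [B], so the comparison keeps
     its direction and its scalar [l]. *)
  have mono (A B : G -> G) l :
      strictly_positive_op A -> strictly_positive_op B ->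
      1 <= l -> (forall y, inner (A y) y <= l * inner (B y) y) ->
      forall x, inner (op_inv (resolvent_op L gamma^-1 (op_inv A)) x) x <=
        l * inner (op_inv (resolvent_op L gamma^-1 (op_inv B)) x) x.
    move=> pA pB l1 AB; have l0 : 0 < l by rewrite (lt_le_trans ltr01).
    apply: op_inv_antitone; [by []|exact: pI..|].
    apply: resolvent_op_le => //; try exact: op_inv_strictly_positive.
    exact: op_inv_antitone.
  split=> [B pB|B pB|A B pA pB].
  + have pB' := op_inv_strictly_positive pB.
    rewrite /resolvent_cocomp sv_inv_fun// resolvent_comp_fun// sv_inv_fun//.
    exact: pI.
  + exact/op_inv_strictly_positive/pI.
  + by apply: thompson_dist_le => //; try exact/op_inv_strictly_positive/pI;
      move=> l; exact: mono.
- exists (resolvent_op L gamma).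
  split=> [B pB|B pB|A B pA pB].
  + exact: resolvent_comp_fun.
  + exact: pR.
  + by apply: thompson_dist_le => //; try exact: pR;
      move=> l l1; exact: resolvent_op_le.
Qed.
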